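(* Let $R$ be a PVMD such that $\mathrm{Spec}_t(R)$ is Noetherian, and let $I$ be a $t$-ideal of $R$. Assume that $I^{-1}$ is a ring. Then the following conditions are equivalent: (1) $I^{-1}=(I:I)$; (2) $I=\sqrt{I}$; (3) the minimal prime ideals of $I$ in the ring $(I:I)$ are all $t$-maximal ideals of $(I:I)$.
   Context: Let $R$ be an integral domain with quotient field $K$. For nonzero fractional ideals $I,J$ of $R$, $(I:J)=\{x\in K : xJ\subseteq I\}$ and $I^{-1}=(R:I)$; ''$I^{-1}$ is a ring'' means that it is a subring of $K$. $(I:I)$ is always a ring between $R$ and $K$, and $I$ is an ideal of it. The $v$-closure is $I_v=(I^{-1})^{-1}$ and the $t$-closure is $I_t=\bigcup J_v$, where $J$ ranges over the nonzero finitely generated subideals of $I$; the same definitions are used for any other domain with quotient field $K$, such as $(I:I)$. A $t$-ideal of $R$ is a nonzero ideal $I\subseteq R$ with $I=I_t$. A $t$-maximal ideal is an ideal maximal among the proper $t$-ideals. A fractional ideal $I$ is $t$-invertible if $(II^{-1})_t=R$. $R$ is a PVMD (Prüfer $v$-multiplication domain) if every nonzero finitely generated ideal of $R$ is $t$-invertible. $\mathrm{Spec}_t(R)$ (the set of nonzero prime $t$-ideals) is said to be Noetherian if $R$ satisfies the ascending chain condition on radical $t$-ideals. *)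

(* Defs.v *)
From HB Require Import structures.
From mathcomp Require Import all_boot all_order all_algebra.
From mathcomp Require Import boolp classical_sets.

Set Implicit Arguments.
Unset Strict Implicit.
Unset Printing Implicit Defensive.

Import GRing.Theory.
Local Open Scope classical_set_scope.
Local Open Scope ring_scope.

(* An integral domain with quotient field K is represented by its image in K:
   a subset A of K satisfying [domain_with_quotient_field A].  Every ideal and
   every fractional ideal is likewise a subset of K, so that the notions below,
   which all take the domain A as a parameter, apply verbatim to R and to
   overrings of R such as (I : I). *)
Section Domains.
Variable K : fieldType.
Implicit Types A I J P M N : set K.

Definition is_subring A : Prop := subring_closed [in A].

Definition domain_with_quotient_field A : Prop :=
  is_subring A /\
  forall x : K, exists a b : K, [/\ A a, A b, b != 0 & x = a / b].

Definition colon I J : set K := [set x | forall y, J y -> I (x * y)].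

Definition inv_ideal A I : set K := colon A I.

Definition v_closure A I : set K := inv_ideal A (inv_ideal A I).

(* The A-submodule of K generated by s. *)
Definition gen_by A (s : seq K) : set K :=
  [set x | exists c : nat -> K,
     (forall i, A (c i)) /\ x = \sum_(i < size s) c i * s`_i].

Definition fin_gen A J : Prop := exists s : seq K, J = gen_by A s.

Definition t_closure A I : set K :=
  [set x | exists J, [/\ fin_gen A J, J <> [set 0], J `<=` I
                       & v_closure A J x]].

Definition is_ideal A I : Prop :=
  [/\ I `<=` A, I 0,
      forall x y, I x -> I y -> I (x + y)
    & forall a x, A a -> I x -> I (a * x)].

Definition t_ideal A I : Prop :=
  [/\ is_ideal A I, I <> [set 0] & I = t_closure A I].

Definition t_maximal A M : Prop :=
  [/\ t_ideal A M, M <> A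
    & forall N, t_ideal A N -> N <> A -> M `<=` N -> N = M].

Definition mul_ideal I J : set K :=
  [set x | exists n (a b : 'I_n -> K),
     (forall i, I (a i) /\ J (b i)) /\ x = \sum_(i < n) a i * b i].

Definition t_invertible A I : Prop :=
  t_closure A (mul_ideal I (inv_ideal A I)) = A.

Definition PVMD A : Prop :=
  forall J, is_ideal A J -> fin_gen A J -> J <> [set 0] -> t_invertible A J.

Definition radical A I : set K :=
  [set x | A x /\ exists2 n : nat, (0 < n)%N & I (x ^+ n)].

Definition radical_t_ideal A I : Prop := t_ideal A I /\ I = radical A I.

Definition Spec_t_noetherian A : Prop :=
  forall J : nat -> set K,
    (forall n, radical_t_ideal A (J n)) ->
    (forall n, J n `<=` J n.+1) ->
    exists n, forall m, (n <= m)%N -> J m = J n.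

Definition prime_ideal A P : Prop :=
  [/\ is_ideal A P, P <> A
    & forall x y, A x -> A y -> P (x * y) -> P x \/ P y].

Definition minimal_prime_over A I P : Prop :=
  [/\ prime_ideal A P, I `<=` P
    & forall Q, prime_ideal A Q -> I `<=` Q -> Q `<=` P -> Q = P].

End Domains.

(* Main.v *)
Require Import Defs.
From mathcomp Require Import all_boot all_order all_algebra.
From mathcomp Require Import boolp classical_sets.
From mathcomp Require Import ring.

Set Implicit Arguments.
Unset Strict Implicit.
Unset Printing Implicit Defensive.

Import GRing.Theory.
Local Open Scope classical_set_scope.
Local Open Scope ring_scope.

(** Everything is checked locally.  For a [t]-maximal ideal [N] of [R], the
    ring [R_N] is a valuation ring: if [(a, b)] is [t]-invertible, then [u * a]
    or [u * b] is outside [N] for some [u] in [(a, b)^-1], and the quotient of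
    [a] and [b], one way or the other, is in [R_N] ([loc_valuation]).  A
    [t]-ideal is the intersection of its localizations at all these [N]
    ([t_ideal_local]).  The ideals of a valuation ring being totally ordered,
    the structure of [I] at a single [N] is easy to control; the difficulty is
    to find elements of [I^-1] with a prescribed behaviour at one [N].

    The chain condition supplies them.  Every nonzero subset [X] of [R]
    contains finitely many elements such that each [t]-maximal ideal containing
    them contains [X] ([finite_t_maximal_support]).  It is applied to colon
    ideals [(I : s)]: at the [t]-maximal ideals containing [(I : s)], the
    element [s] is not in [I] locally, so that it divides all of [I]; at the
    others, one of the finitely many elements is a unit.  Hence the inverse of
    the ideal generated by [s] and these elements lies in [I^-1]
    ([inv_ideal_local_inverse]).

    Let [I^-1 = (I : I)], and let [x] be in the radical of [I] but not in [I]
    locally at [M].  The construction gives [u] in [I^-1] such that [u * x] is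
    a unit at [M]; since [u] maps [I] to itself, a power of the unit [u * x] is
    in [I], and this is absurd ([radical_of_inv_colon]).  Conversely, if [I] is
    radical, [x] is in [I^-1] and [a] in [I], then
    [(x * a) ^+ 2 = (x ^+ 2 * a) * a] is in [I], hence so is [x * a]
    ([inv_colon_of_radical]).

    Let [I] be radical, so that [T = (I : I)] is [I^-1], and let [P] be a prime
    of [T] minimal over [I].  Any [y] in [T] outside [P] generates, with
    finitely many elements of [(I : y)], which is contained in [P], an ideal of
    [T] with inverse [T].  So no proper [t]-ideal of [T] strictly contains [P]
    ([t_maximal_of_radical]).

    Finally, let all primes of [T] minimal over [I] be [t]-maximal in [T].  At
    each [N] containing [I], the elements of [T] that are nilpotent modulo
    [I R_N] form such a minimal prime, and the elements [w] with
    [w I R_N <> I R_N] form a [t]-ideal above it.  These are therefore equal: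
    an element of [T] either has a power in [I R_N] or maps [I R_N] onto
    itself.  With this dichotomy, the ring [I^-1] maps each [I R_N] into itself
    ([inv_colon_of_t_maximal]). *)

(** * Subrings, generated ideals and t-ideals *)

Section Subrings.
Context (K : fieldType) (A : set K) (hA : is_subring A).

Lemma subring1 : A 1.
Proof. by case: hA; rewrite in_setE. Qed.

Lemma subringB x y : A x -> A y -> A (x - y).
Proof. by case: hA => _ + _ Ax Ay => /(_ x y); rewrite !in_setE; apply. Qed.

Lemma subringM x y : A x -> A y -> A (x * y).
Proof. by case: hA => _ _ + Ax Ay => /(_ x y); rewrite !in_setE; apply. Qed.

Lemma subring0 : A 0.
Proof. by rewrite -(subrr 1); apply: subringB; apply: subring1. Qed.

Lemma subringD x y : A x -> A y -> A (x + y).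
Proof.
move=> Ax Ay; rewrite -[y]opprK -[- y]sub0r; apply: subringB => //.
by apply: subringB => //; apply: subring0.
Qed.

Lemma subringX x n : A x -> A (x ^+ n).
Proof.
move=> Ax; elim: n => [|n IHn]; first exact: subring1.
by rewrite exprS; apply: subringM.
Qed.

Lemma subring_ideal : is_ideal A A.
Proof.
split=> // [|x y|a x]; first exact: subring0; first exact: subringD.
exact: subringM.
Qed.

Lemma gen_by_mem s f : f \in s -> gen_by A s f.
Proof.
move=> /(nthP 0) [i lt_i <-].
exists (fun j => if j == i then 1 else 0); split.
  by move=> j; case: ifP => _; [apply: subring1 | apply: subring0].
rewrite (bigD1 (Ordinal lt_i)) //= eqxx mul1r big1 ?addr0 // => j.
by rewrite -val_eqE /= => /negbTE ->; rewrite mul0r.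
Qed.

(** Closure is asked only under the operations, so that the lemma also serves
    for fractional ideals. *)
Lemma gen_by_sub s (X : set K) :
    X 0 -> (forall x y, X x -> X y -> X (x + y)) ->
    (forall a x, A a -> X x -> X (a * x)) ->
  (forall f, f \in s -> X f) -> gen_by A s `<=` X.
Proof.
move=> X0 XD XM sX x [c [Ac ->]].
elim/big_rec: _ => // i y _ Xy; apply: XD => //; apply: XM => //.
by apply: sX; apply: mem_nth.
Qed.

Lemma gen_by_ideal s : (forall f, f \in s -> A f) -> is_ideal A (gen_by A s).
Proof.
move=> sA; split.
- by apply: gen_by_sub => //; [apply: subring0|apply: subringD|apply: subringM].
- exists (fun=> 0); split=> [_|]; first exact: subring0.
  by rewrite big1 // => i _; rewrite mul0r.
- move=> _ _ [c [Ac ->]] [d [Ad ->]]; exists (fun i => c i + d i).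
  split=> [i|]; first exact: subringD.
  by rewrite -big_split; apply: eq_bigr => i _; rewrite mulrDl.
- move=> a _ Aa [c [Ac ->]]; exists (fun i => a * c i).
  split=> [i|]; first exact: subringM.
  by rewrite mulr_sumr; apply: eq_bigr => i _; rewrite mulrA.
Qed.

Lemma gen_by_neq0 s : (exists2 f, f \in s & f != 0) -> gen_by A s <> [set 0].
Proof.
by case=> f sf /eqP f0 eq0; apply: f0; have := gen_by_mem sf; rewrite eq0.
Qed.

Lemma inv_ideal_gen s u :
  inv_ideal A (gen_by A s) u <-> (forall f, f \in s -> A (u * f)).
Proof.
split=> [Au f sf|Au x]; first exact/Au/gen_by_mem.
apply: (@gen_by_sub s (fun x => A (u * x))) => // {x} [|x y Ax Ay|a x Aa Ax].
- by rewrite mulr0; apply: subring0.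
- by rewrite mulrDr; apply: subringD.
- by rewrite mulrCA; apply: subringM.
Qed.

Lemma v_closure_gen s z : v_closure A (gen_by A s) z <->
  (forall u, (forall f, f \in s -> A (u * f)) -> A (z * u)).
Proof.
by split=> Az u Au; apply: Az; apply/inv_ideal_gen.
Qed.

(** Over generating sequences, being a [t]-ideal no longer mentions the ideals
    that these sequences generate. *)
Lemma t_idealE (I : set K) : t_ideal A I <->
  [/\ is_ideal A I, exists2 x, I x & x != 0
    & forall (s : seq K) z,
        (forall f, f \in s -> I f) -> (exists2 f, f \in s & f != 0) ->
        (forall u, (forall f, f \in s -> A (u * f)) -> A (z * u)) -> I z].
Proof.
have genI (s : seq K) :
    is_ideal A I -> (forall f, f \in s -> I f) -> gen_by A s `<=` I.
  by case=> IA I0 ID IM sI; apply: gen_by_sub.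
split=> [[idI In0 Icl]|[idI [x0 Ix0 x0n0] Icl]].
  split=> //.
    apply: contrapT => noI; apply: In0; apply/seteqP; split=> x /=.
      by move=> Ix; apply: contrapT => /eqP xn0; apply: noI; exists x.
    by move=> ->; case: idI.
  move=> s z sI sn0 vz; rewrite Icl; exists (gen_by A s); split.
  - by exists s.
  - exact: gen_by_neq0.
  - exact: genI.
  - exact/v_closure_gen.
split=> //; first by move=> eqI; move: x0n0; rewrite eqI in Ix0; rewrite Ix0 eqxx.
apply/seteqP; split=> x.
  (* 0 is absorbed by any nonzero element, as the zero module is excluded. *)
  move=> Ix; pose y := if x == 0 then x0 else x.
  have yn0 : y != 0 by rewrite /y; case: ifP => // /negbT.
  have Iy : I y by rewrite /y; case: ifP.
  have syI : forall f, f \in [:: y] -> I f by move=> f; rewrite inE => /eqP ->.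
  exists (gen_by A [:: y]); split; first by exists [:: y].
  - by apply: gen_by_neq0; exists y; rewrite ?inE.
  - exact: genI.
  - apply/v_closure_gen => u /(_ y); rewrite inE eqxx mulrC => /(_ isT).
    rewrite /y; case: eqP => [->|//]; rewrite mul0r => _; exact: subring0.
case=> _ [[s ->] sn0 sI vz]; apply: (Icl s) => [f sf||].
- exact/sI/gen_by_mem.
- apply: contrapT => s0; apply: sn0; apply/seteqP; split=> y /=.
    apply: (@gen_by_sub s [set 0]) => [//|a b -> ->|a b _ ->|f sf];
      rewrite ?addr0 ?mulr0 //.
    by apply: contrapT => /eqP fn0; apply: s0; exists f.
  move=> ->; case: (gen_by_ideal (s := s)) => // f /gen_by_mem /sI.
  by case: idI => + _ _ _; apply.
- exact/v_closure_gen.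
Qed.

Lemma t_ideal_subring : t_ideal A A.
Proof.
apply/t_idealE; split; first exact: subring_ideal.
  by exists 1; [apply: subring1 | apply: oner_neq0].
move=> s z sA _ /(_ 1); rewrite mulr1; apply => f sf; rewrite mul1r; exact: sA.
Qed.

Lemma t_ideal_colon (I : set K) x : t_ideal A I ->
  (exists2 r, A r /\ I (r * x) & r != 0) ->
  t_ideal A [set r | A r /\ I (r * x)].
Proof.
move=> /t_idealE [[IA I0 ID IM] In0 Icl] rn0; apply/t_idealE; split => //.
  split=> [r []//||r r' [Ar Ir] [Ar' Ir']|a r Aa [Ar Ir]].
  - by rewrite /= mul0r; split=> //; apply: subring0.
  - by rewrite /= mulrDl; split; [apply: subringD|apply: ID].
  - by rewrite /= -mulrA; split; [apply: subringM|apply: IM].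
have [->|xn0] := eqVneq x 0.
  move=> s z sA _ vz; rewrite /= mulr0; split=> //.
  by rewrite -[z]mulr1; apply: vz => f /sA []; rewrite mul1r.
move=> s z sA [f0 sf0 f0n0] vz; split.
  by rewrite -[z]mulr1; apply: vz => f /sA []; rewrite mul1r.
apply: (Icl [seq f * x | f <- s]).
- by move=> _ /mapP[f /sA [_ If] ->].
- by exists (f0 * x); [apply: map_f | rewrite mulf_neq0].
- move=> u Au; rewrite -mulrA; apply: vz => f sf.
  by have ->: x * u * f = u * (f * x) by [ring]; apply/Au/map_f.
Qed.

End Subrings.

(** * Maximal elements *)

(** Zorn's lemma for a property of subsets that is inherited by unions of
    nonempty chains. *)
Lemma chain_maximal (T : Type) (Phi : set T -> Prop) (J0 : set T) (x0 : T) :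
    J0 x0 -> Phi J0 ->
    (forall F : set (set T), (exists X, F X) -> (forall X, F X -> Phi X) ->
       total_on F subset -> Phi (\bigcup_(X in F) X)) ->
  exists M, [/\ Phi M, J0 `<=` M & forall X, Phi X -> M `<=` X -> X = M].
Proof.
move=> J0x0 PhiJ0 chain.
pose P (X : set T) := X = set0 \/ Phi X /\ J0 `<=` X.
have [|M [PM maxM]] := @Zorn_bigcup T P.
  move=> F FP Ftot.
  have [Fne|Fe] := pselect (exists2 X, F X & X <> set0); last first.
    left; apply/seteqP; split=> x // [X FX Xx]; apply: Fe; exists X => //.
    by move=> X0; rewrite X0 in Xx.
  pose G := [set X | F X /\ X <> set0].
  have <- : \bigcup_(X in G) X = \bigcup_(X in F) X.
    apply/seteqP; split=> x [X FX Xx]; exists X => //; first by case: FX.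
    by split=> // X0; rewrite X0 in Xx.
  have GP X : G X -> Phi X /\ J0 `<=` X by case=> /FP [].
  right; split.
    apply: chain.
    - by case: Fne => X FX Xn0; exists X.
    - by move=> X /GP [].
    - by move=> X Y [FX _] [FY _]; apply: Ftot.
  by case: Fne => X FX Xn0 x J0x; exists X => //; apply: (GP X _).2.
have J0M : J0 `<=` M /\ Phi M.
  case: PM => [M0|[]//]; exfalso; apply: (maxM J0); last by right; split.
  by split; rewrite M0 // => /(_ _ J0x0).
case: J0M => J0M PhiM; exists M; split=> // X PhiX MX.
apply/seteqP; split=> //; apply: contrapT => XM.
by apply: (maxM X); [split | right; split=> //; apply: subset_trans MX].
Qed.

Lemma chain_seq (T : eqType) (F : set (set T)) (s : seq T) :
    (exists X, F X) -> total_on F subset ->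
    (forall f, f \in s -> (\bigcup_(X in F) X) f) ->
  exists2 X, F X & forall f, f \in s -> X f.
Proof.
move=> [X0 FX0] Ftot; elim: s => [|g s IHs] sF; first by exists X0.
have [|X FX sX] := IHs; first by move=> f sf; apply: sF; rewrite inE sf orbT.
have [|Y FY Yg] := sF g; first by rewrite inE eqxx.
case: (Ftot _ _ FX FY) => [XY|YX]; [exists Y|exists X] => // f;
  rewrite inE => /predU1P [->|/sX]; auto.
Qed.

Lemma ideal_chain (K : fieldType) (A : set K) (F : set (set K)) :
    (exists X, F X) -> (forall X, F X -> is_ideal A X) ->
  total_on F subset -> is_ideal A (\bigcup_(X in F) X).
Proof.
move=> Fne Fid Ftot; split.
- by move=> x [X /Fid [XA _ _ _] /XA].
- by case: Fne => X FX; exists X => //; case: (Fid X FX).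
- move=> x y xF yF.
  have [f|X FX sX] := @chain_seq _ F [:: x; y] Fne Ftot.
    by rewrite !inE => /orP [] /eqP ->.
  exists X => //; case: (Fid X FX) => _ _ XD _.
  by apply: XD; apply: sX; rewrite !inE eqxx ?orbT.
- by move=> a x Aa [X FX Xx]; exists X => //; case: (Fid X FX) => _ _ _; apply.
Qed.

Section MinimalPrimes.
Context (K : fieldType) (A : set K) (hA : is_subring A).

(** In the localization of [A] at a minimal prime [P] of [I], the ideal
    generated by [P] is the radical of that generated by [I].  An ideal that
    contains [I] and is maximal among those missing the multiplicative set of
    all [y * f ^+ n] with [y] outside [P] is prime and contained in [P]. *)
Lemma minimal_prime_over_pow (I P : set K) f :
    is_ideal A I -> minimal_prime_over A I P -> P f ->
  exists y n, [/\ A y, ~ P y & I (y * f ^+ n)].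
Proof.
move=> idI [[idP PnA Pprime] IP minP] Pf.
have [PA P0 PD PM] := idP; have A1 := subring1 hA.
have nP1 : ~ P 1.
  move=> P1; apply: PnA; apply/seteqP; split=> // x Ax.
  by rewrite -[x]mulr1; apply: PM.
apply: contrapT => noyn.
pose Phi X := [/\ is_ideal A X, I `<=` X
  & forall y n, A y -> ~ P y -> ~ X (y * f ^+ n)].
have [|||Q [[idQ IQ Qmiss] _ maxQ]] := @chain_maximal _ Phi I 0.
- by case: idI.
- by split=> // y n Ay nPy Iy; apply: noyn; exists y, n.
- move=> F Fne FP Ftot; split; first by apply: ideal_chain => // X /FP [].
  + by case: Fne => X FX x Ix; exists X => //; case: (FP X FX) => _ + _; apply.
  + by move=> y n Ay nPy [X /FP [_ _ Xmiss] /Xmiss]; apply.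
have [QA Q0 QD QM] := idQ.
have enlarge a : A a -> ~ Q a ->
    exists c y n, [/\ A c, A y, ~ P y & Q (y * f ^+ n + c * a)].
  move=> Aa nQa; apply: contrapT => noc.
  pose X := [set x | exists2 c, A c & Q (x + c * a)].
  apply: nQa; have QX : Q `<=` X.
    move=> x Qx; exists 0; first exact: subring0.
    by rewrite mul0r addr0.
  suff <- : X = Q.
    exists (- 1); last by rewrite mulN1r subrr.
    by rewrite -sub0r; apply: subringB => //; apply: subring0.
  apply: maxQ => //; split=> [||y n Ay nPy [c Ac Qy]].
  - split=> [x [c Ac Qx]|| x x' [c Ac Qx] [c' Ac' Qx'] | b x Ab [c Ac Qx]].
    + rewrite -(addrK (c * a) x); apply: subringB => //; first exact: QA.
      exact: subringM.
    + exact: QX.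
    + exists (c + c'); first exact: subringD.
      by rewrite mulrDl addrACA; apply: QD.
    + exists (b * c); first exact: subringM.
      by rewrite -mulrA -mulrDr; apply: QM.
  - exact: subset_trans QX.
  - by apply: noc; exists c, y, n.
have Qprime : prime_ideal A Q.
  split=> // [QeqA|a b Aa Ab Qab].
    by apply: (Qmiss 1 0%N) => //; rewrite mulr1 QeqA.
  have [Qa|nQa] := pselect (Q a); [by left | right].
  apply: contrapT => nQb.
  have [c [y [n [Ac Ay nPy Qy]]]] := enlarge a Aa nQa.
  have [c' [y' [n' [Ac' Ay' nPy' Qy']]]] := enlarge b Ab nQb.
  apply: (Qmiss (y * y') (n + n')%N); first exact: subringM.
    by move=> /(Pprime y y' Ay Ay') [].
  have -> : y * y' * f ^+ (n + n') = y' * f ^+ n' * (y * f ^+ n + c * a)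
      + - (c * a) * (y' * f ^+ n' + c' * b) + c * c' * (a * b).
    by rewrite exprD; ring.
  have Af m : A (f ^+ m) by apply: subringX => //; apply: PA.
  apply: (QD); [apply: QD|]; apply: QM => //.
  - exact: subringM.
  - by rewrite -sub0r; apply: subringB; [|apply: subring0|apply: subringM].
  - exact: subringM.
have QP : Q `<=` P.
  move=> x Qx; apply: contrapT => nPx; apply: (Qmiss x 0%N) => //.
    exact: QA.
  by rewrite mulr1.
have PQ := minP _ Qprime IQ QP.
by apply: (Qmiss 1 1%N) => //; rewrite mul1r PQ.
Qed.

End MinimalPrimes.

(** * Maximal t-ideals *)

Section TMaximal.
Context (K : fieldType) (R : set K) (hR : is_subring R).

Lemma ideal1_eq (I : set K) : is_ideal R I -> I 1 -> I = R.
Proof.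
case=> IR _ _ IM I1; apply/seteqP; split=> // x Rx.
by rewrite -[x]mulr1; apply: IM.
Qed.

Lemma t_maximal_above (J : set K) :
  t_ideal R J -> J <> R -> exists2 N, t_maximal R N & J `<=` N.
Proof.
move=> tJ JnR; have [idJ _ _] := tJ.
have [|||N [[tN nN1] JN maxN]] :=
    @chain_maximal _ (fun X => t_ideal R X /\ ~ X 1) J 0.
- by case: idJ.
- by split=> // J1; apply/JnR/ideal1_eq.
- move=> F Fne FP Ftot; split; last by case=> X /FP [].
  have Ft X : F X -> t_ideal R X by case/FP.
  apply/(t_idealE hR); split.
  + by apply: ideal_chain => // X /Ft [].
  + case: Fne => X FX; have /(t_idealE hR)[_ [x Xx xn0] _] := Ft X FX.
    by exists x => //; exists X.
  + move=> s z sF sn0 vz; have [X FX sX] := chain_seq Fne Ftot sF.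
    have /(t_idealE hR)[_ _ Xcl] := Ft X FX.
    by exists X => //; apply: (Xcl s).
exists N => //; split=> // [NR|X tX XnR NX].
  by apply: nN1; rewrite NR; apply: subring1.
by apply: maxN => //; split=> // X1; apply: XnR; apply: ideal1_eq => //; case: tX.
Qed.

(** For [x] outside [N], the colon ideal [(N : x)] is a proper [t]-ideal
    containing [N]. *)
Lemma t_maximal_prime (N : set K) : t_maximal R N -> prime_ideal R N.
Proof.
case=> tN NnR maxN; have [idN _ _] := tN; split=> // x y Rx Ry Nxy.
have [NR _ _ NM] := idN.
have [Nx|nNx] := pselect (N x); [by left | right].
have /(t_idealE hR)[_ [a Na an0] _] := tN.
have tC : t_ideal R [set r | R r /\ N (r * x)].
  apply: t_ideal_colon => //; exists a => //; split; first exact: NR.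
  by rewrite mulrC; apply: NM.
rewrite -(maxN _ tC) /=; first by rewrite mulrC.
  move=> CR; apply: nNx; have : [set r | R r /\ N (r * x)] 1.
    by rewrite CR; apply: subring1.
  by case; rewrite mul1r.
by move=> b Nb; split; [apply: NR | rewrite mulrC; apply: NM].
Qed.

Lemma prime_idealN1 (P : set K) : prime_ideal R P -> ~ P 1.
Proof. by case=> idP PnR _ P1; apply/PnR/ideal1_eq. Qed.

Lemma prime_idealX (P : set K) x n :
  prime_ideal R P -> R x -> P (x ^+ n) -> P x.
Proof.
move=> primeP Rx; elim: n => [/(prime_idealN1 primeP) //|n IHn].
rewrite exprS => Pxx; case: primeP => _ _ /(_ _ _ _ _ Pxx) [] //.
exact: subringX.
Qed.

Lemma prime_idealNM (P : set K) x y :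
  prime_ideal R P -> R x -> R y -> ~ P x -> ~ P y -> ~ P (x * y).
Proof. by case=> _ _ pP Rx Ry nPx nPy /pP []. Qed.

End TMaximal.

(** * Localization at a prime *)

(** The module [I R_N], for a prime ideal [N] of [R]; the ring [R_N] is
    [loc R N R]. *)
Definition loc (K : fieldType) (R N I : set K) : set K :=
  [set x | exists2 t, R t /\ ~ N t & I (t * x)].

Section Localization.
Context (K : fieldType) (R N : set K) (hR : is_subring R).
Context (primeN : prime_ideal R N).
Implicit Types I : set K.

Lemma subset_loc I : I `<=` loc R N I.
Proof.
move=> x Ix; exists 1; last by rewrite mul1r.
by split; [apply: subring1 | apply: prime_idealN1 primeN].
Qed.

Lemma locM I a x : is_ideal R I -> loc R N R a -> loc R N I x ->
  loc R N I (a * x).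
Proof.
move=> [_ _ _ IM] [t [Rt nNt] Rta] [t' [Rt' nNt'] It'x].
exists (t * t').
  by split; [apply: subringM | apply: (prime_idealNM primeN)].
by rewrite mulrACA; apply: IM.
Qed.

Lemma loc_act I w x : colon I I w -> loc R N I x -> loc R N I (w * x).
Proof.
by move=> Iw [t Rt Itx]; exists t => //; rewrite mulrCA; apply: Iw.
Qed.

Lemma loc_cancel I t x : R t -> ~ N t -> loc R N I (t * x) -> loc R N I x.
Proof.
move=> Rt nNt [t' [Rt' nNt'] Ix]; exists (t' * t); last by rewrite -mulrA.
by split; [apply: subringM | apply: (prime_idealNM primeN)].
Qed.

Lemma loc1 I : loc R N I 1 <-> exists a, [/\ R a, ~ N a & I a].
Proof.
split=> [[a [Ra nNa]]|[a [Ra nNa Ia]]]; first by rewrite mulr1; exists a.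
by exists a => //; rewrite mulr1.
Qed.

Lemma loc_full I x : loc R N I 1 -> colon I I x -> loc R N I x.
Proof.
case=> a Ra; rewrite mulr1 => Ia xI; exists a => //.
by rewrite mulrC; apply: xI.
Qed.

End Localization.

(** * Prüfer v-multiplication domains are locally valuation rings *)

Section PVMDs.
Context (K : fieldType) (R : set K).
Context (hR : domain_with_quotient_field R) (hPVMD : PVMD R).
Let hsR : is_subring R := hR.1.
Let prime_max N (tN : t_maximal R N) := t_maximal_prime hsR tN.

(** The [t]-ideal [(I : x)] of [R] is contained in no [t]-maximal ideal. *)
Lemma t_ideal_local (I : set K) x : t_ideal R I ->
  (forall N, t_maximal R N -> loc R N I x) -> I x.
Proof.
move=> tI locx; have /(t_idealE hsR)[[IR I0 _ IM] [i Ii in0] _] := tI.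
have tC : t_ideal R [set r | R r /\ I (r * x)].
  apply: (t_ideal_colon hsR tI).
  have [a [b [Ra Rb bn0 ->]]] := hR.2 x.
  exists (i * b); last by rewrite mulf_neq0.
  split; first by apply: subringM => //; apply: IR.
  have -> : i * b * (a / b) = a * i by field.
  exact: IM.
have [CR|CnR] := pselect ([set r | R r /\ I (r * x)] = R).
  have : [set r | R r /\ I (r * x)] 1 by rewrite CR; apply: subring1.
  by case; rewrite mul1r.
have [N tN CN] := t_maximal_above hsR tC CnR.
by have [t [Rt nNt] Itx] := locx N tN; case: nNt; apply: CN.
Qed.

(** With [x / y = a / b], the element [u] of the inverse of [(a, b)] that makes
    [u * a] or [u * b] a unit at [N] exists because [(a, b)] times its inverse,
    having [t]-closure [R], is not contained in the [t]-ideal [N]. *)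
Lemma loc_valuation N x y : t_maximal R N ->
  loc R N R (x / y) \/ loc R N R (y / x).
Proof.
move=> tN; have primeN := prime_max tN; have [[NR N0 ND NM] NnR _] := primeN.
have V0 : loc R N R 0 by apply: subset_loc => //; apply: subring0.
have [->|xn0] := eqVneq x 0; first by left; rewrite mul0r.
have [->|yn0] := eqVneq y 0; first by right; rewrite mul0r.
have [a [b [Ra Rb bn0 xyE]]] := hR.2 (x / y).
have an0 : a != 0.
  apply: contraNneq xn0 => a0; move/eqP: xyE; rewrite a0 mul0r.
  by rewrite mulf_eq0 invr_eq0 (negbTE yn0) orbF.
have yxE : y / x = b / a by rewrite -[y / x]invrK invf_div xyE invf_div.
have sR f : f \in [:: a; b] -> R f by rewrite !inE => /orP [] /eqP ->.
set J := gen_by R [:: a; b].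
have clJ : t_closure R (mul_ideal J (inv_ideal R J)) = R.
  apply: hPVMD; [exact: gen_by_ideal | by exists [:: a; b] |].
  by apply: gen_by_neq0 => //; exists a; rewrite ?inE ?eqxx.
have [JN|] := pselect (mul_ideal J (inv_ideal R J) `<=` N).
  (* Otherwise the whole ring would lie in the t-closure of N. *)
  case: NnR; apply/seteqP; split=> // x'; rewrite -{1}clJ.
  case=> F [genF Fn0 FJ vF]; have [[_ _ ->] _ _] := tN.
  by exists F; split=> //; apply: subset_trans JN.
move=> nJN; apply: contrapT => /not_orP [nVx nVy]; apply: nJN.
move=> _ [n [f [u [fu ->]]]].
elim/big_rec: _ => // i z _ Nz; apply: (ND) => //; case: (fu i) => {fu} Jf Ju.
have Rua : R (u i * a) by apply/Ju/gen_by_mem; rewrite ?inE ?eqxx.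
have Rub : R (u i * b) by apply/Ju/gen_by_mem; rewrite ?inE ?eqxx ?orbT.
rewrite mulrC; move: (f i) Jf.
apply: gen_by_sub => [|c d Nc Nd|c d Rc Nd|c]; rewrite ?mulr0 ?mulrDr //.
- exact: ND.
- by rewrite mulrCA; apply: NM.
- rewrite !inE => /orP [] /eqP ->; apply: contrapT => nN.
    apply: nVy; exists (u i * a) => //; rewrite yxE.
    by have -> : u i * a * (b / a) = u i * b by field.
  apply: nVx; exists (u i * b) => //; rewrite xyE.
  by have -> : u i * b * (a / b) = u i * a by field.
Qed.

(** Locally at [N] the module generated by [s] is generated by one of its
    given generators, namely one of least value; [u] is a common denominator of
    the quotients by it, divided by it. *)
Lemma loc_principal N (s : seq K) : t_maximal R N ->
    (exists2 f, f \in s & f != 0) ->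
  exists f u, [/\ f \in s, forall g, g \in s -> R (u * g) & ~ N (u * f)].
Proof.
move=> tN; have primeN := prime_max tN.
have R0 := subring0 hsR.
elim: s => [[f //]|g s IHs] sn0.
have [sn0'|s0] := pselect (exists2 f, f \in s & f != 0); last first.
  have s0' f : f \in s -> f = 0.
    by move=> sf; apply: contrapT => /eqP fn0; apply: s0; exists f.
  have gn0 : g != 0.
    case: sn0 => f; rewrite inE => /predU1P [-> //|/s0' ->]; by rewrite eqxx.
  exists g, g^-1; rewrite inE eqxx mulVf //; split=> // [h|].
    rewrite inE => /predU1P [->|/s0' ->]; rewrite ?mulVf ?mulr0 //.
    exact: subring1.
  exact: prime_idealN1 primeN.
have [f [u [sf Ru nNuf]]] := IHs sn0'.
have [g0|gn0] := eqVneq g 0.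
  exists f, u; rewrite inE sf orbT; split=> // h.
  by rewrite inE => /predU1P [->|/Ru //]; rewrite g0 mulr0.
have fn0 : f != 0.
  by apply/eqP => f0; apply: nNuf; rewrite f0 mulr0; case: primeN => -[].
case: (loc_valuation g f tN) => -[t [Rt nNt] Rtgf].
  exists f, (t * u); rewrite inE sf orbT; split=> // [h|].
    rewrite inE => /predU1P [->|/Ru Ruh]; last by rewrite -mulrA; apply: subringM.
    have -> : t * u * g = t * (g / f) * (u * f) by field.
    by apply: subringM => //; apply: Ru.
  by rewrite -mulrA; apply: (prime_idealNM primeN) => //; apply: Ru.
exists g, (t * u * (f / g)); rewrite inE eqxx; split=> // [h|].
  rewrite inE => /predU1P [->|/Ru Ruh].
    have -> : t * u * (f / g) * g = t * (u * f) by field.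
    by apply: subringM => //; apply: Ru.
  have -> : t * u * (f / g) * h = t * (f / g) * (u * h) by ring.
  exact: subringM.
have -> : t * u * (f / g) * g = t * (u * f) by field.
by apply: (prime_idealNM primeN) => //; apply: Ru.
Qed.

End PVMDs.

(** * The chain condition on radical t-ideals *)

Section Noetherian.
Context (K : fieldType) (R : set K) (hsR : is_subring R).
Context (hSpec : Spec_t_noetherian R).

Let rad (s : seq K) : set K :=
  [set z | R z /\ forall N, t_maximal R N -> (forall f, f \in s -> N f) -> N z].

Lemma radical_t_ideal_bigcap (s : seq K) : (forall f, f \in s -> R f) ->
  (exists2 f, f \in s & f != 0) -> radical_t_ideal R (rad s).
Proof.
move=> sR sn0; split.
  apply/(t_idealE hsR); split.
  - split=> [z []//||x y [Rx Nx] [Ry Ny]|a x Ra [Rx Nx]].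
    + split; first exact: subring0.
      by move=> N tN _; case: (t_maximal_prime hsR tN) => -[].
    + split; first exact: subringD.
      move=> N tN sN; case: (t_maximal_prime hsR tN) => -[_ _ ND _] _ _.
      by apply: ND; [apply: Nx | apply: Ny].
    + split; first exact: subringM.
      move=> N tN sN; case: (t_maximal_prime hsR tN) => -[_ _ _ NM] _ _.
      by apply: NM => //; apply: Nx.
  - case: sn0 => f sf fn0; exists f => //.
    by split; [apply: sR | move=> N _; apply].
  - move=> s' z s'N s'n0 vz; split.
      by rewrite -[z]mulr1; apply: vz => f /s'N []; rewrite mul1r.
    move=> N tN sN; have [/(t_idealE hsR)[_ _ Ncl] _ _] := tN.
    by apply: (Ncl s') => // f /s'N [_]; apply.
apply/seteqP; split=> z.
  by move=> Nz; split; [case: Nz | exists 1%N].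
case=> Rz [n _ [_ Nzn]]; split=> // N tN sN.
by apply: (prime_idealX hsR (t_maximal_prime hsR tN) Rz (n := n)); apply: Nzn.
Qed.

(** Otherwise one adds, again and again, an element of [X] that some
    [t]-maximal ideal containing the earlier elements misses; the
    intersections of the [t]-maximal ideals containing these finite sets then
    form a strictly increasing sequence of radical [t]-ideals. *)
Lemma finite_t_maximal_support (X : set K) :
    X `<=` R -> (exists2 x, X x & x != 0) ->
  exists2 s : seq K, forall f, f \in s -> X f
    & forall N, t_maximal R N -> (forall f, f \in s -> N f) -> X `<=` N.
Proof.
move=> XR [x0 Xx0 x0n0]; apply: contrapT => nos.
have step (s : seq K) : exists x, (forall f, f \in s -> X f) -> X x /\ ~ rad s x.
  apply: contrapT => nox; apply: nos; exists s.
    apply: contrapT => nsX; apply: nox; exists 0 => sX; by case: nsX.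
  move=> N tN sN x Xx; apply: contrapT => nNx; apply: nox; exists x.
  by move=> _; split=> // -[_ /(_ N tN sN)].
have [next nextP] := choice step.
pose s_ n := iter n (fun s => next s :: s) [:: x0].
have sX n f : f \in s_ n -> X f.
  elim: n f => [|n IHn] f /=; first by rewrite inE => /eqP ->.
  by rewrite inE => /predU1P [->|/IHn //]; case: (nextP _ IHn).
have sx0 n : x0 \in s_ n.
  by elim: n => [|n IHn] /=; rewrite inE ?eqxx // IHn orbT.
have [||n stat] := hSpec (J := fun n => rad (s_ n)).
- move=> n; apply: radical_t_ideal_bigcap; last by exists x0.
  by move=> f /sX /XR.
- move=> n z [Rz Nz]; split=> // N tN sN; apply: Nz => // f sf.
  by apply: sN; rewrite /= inE sf orbT.
case: (nextP _ (@sX n)) => Xx; rewrite -(stat n.+1) //; apply.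
by split; [apply: XR | move=> N _; apply; rewrite /= inE eqxx].
Qed.

End Noetherian.

(** * When the inverse of a t-ideal is its ring of multipliers *)

Section MainImplications.
Context (K : fieldType) (R : set K).
Context (hR : domain_with_quotient_field R) (hPVMD : PVMD R).
Let hsR : is_subring R := hR.1.
Let prime_max N (tN : t_maximal R N) := t_maximal_prime hsR tN.

(** Let [s0] be finitely many elements of [(I : s)] lying in [s R_M], such that
    the [t]-maximal ideals containing [s0] contain every element of [(I : s)]
    in [s R_M], hence all of [(I : s)] by the assumption on powers.  At [M] the
    ideal generated by [s] and [s0] is [s R_M], so that some [u] in its inverse
    makes [u * s] a unit.  This [u] maps [I] into [R]: at a [t]-maximal [N]
    containing [(I : s)], the element [s] is not in [I R_N], so it divides all
    of [I], and [u * s] is in [R]; at any other [N], some [k] in [s0] is a unit,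
    and [u * k] is in [R]. *)
Lemma inv_ideal_local_inverse (hSpec : Spec_t_noetherian R) (I M : set K) s :
    t_ideal R I -> t_maximal R M -> R s -> s != 0 ->
    (forall c, R c -> I (c * s) -> exists n, loc R M R (c ^+ n.+1 / s)) ->
  exists u, [/\ inv_ideal R I u, R (u * s) & ~ M (u * s)].
Proof.
move=> tI tM Rs sn0 powM; have primeM := prime_max tM.
have /(t_idealE hsR)[[IR I0 ID IM] [i Ii in0] _] := tI.
pose X := [set c | [/\ R c, I (c * s) & loc R M R (c / s)]].
have [||s0 s0X suppX] := @finite_t_maximal_support _ R hsR hSpec X.
- by move=> c [].
- exists (i * s); last by rewrite mulf_neq0.
  have Ris : R (i * s) by apply: subringM => //; apply: IR.
  split=> //.
    have -> : i * s * s = s * s * i by ring.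
    by apply: IM => //; apply: subringM.
  by rewrite mulfK //; apply: subset_loc => //; apply: IR.
have [|f [u [sf Ru nMuf]]] := loc_principal hR hPVMD (s := s :: s0) tM.
  by exists s; rewrite ?inE ?eqxx.
have Rus : R (u * s) by apply: Ru; rewrite inE eqxx.
have nMus : ~ M (u * s).
  move: sf; rewrite inE => /predU1P [<- //|s0f Mus].
  have [_ _ [t [Rt nMt] Rtfs]] := s0X f s0f.
  apply: (prime_idealNM primeM Rt _ nMt nMuf).
    by apply: Ru; rewrite inE s0f orbT.
  have -> : t * (u * f) = t * (f / s) * (u * s) by field.
  by case: primeM => -[_ _ _ MM] _ _; apply: MM.
exists u; split=> // a Ia.
apply: (t_ideal_local hR (t_ideal_subring hsR)) => N tN.
have primeN := prime_max tN; have [[_ N0 _ NM] _ _] := primeN.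
have [s0N|] := pselect (forall f, f \in s0 -> N f); last first.
  move=> s0N; have [k s0k nNk] : exists2 k, k \in s0 & ~ N k.
    apply: contrapT => nok; apply: s0N => k s0k; apply: contrapT => nNk.
    by apply: nok; exists k.
  have [Rk _ _] := s0X k s0k; exists k => //.
  rewrite mulrCA mulrA; apply: subringM => //; last exact: IR.
  by apply: Ru; rewrite inE s0k orbT.
have colonN c : R c -> I (c * s) -> N c.
  move=> Rc Ics; have [n [t [Rt nMt] Rtcs]] := powM c Rc Ics.
  apply: (prime_idealX hsR primeN Rc (n := n.+1)).
  apply: (suppX N tN s0N); split; first exact: subringX.
    by rewrite exprSr -mulrA; apply: IM => //; apply: subringX.
  by exists t.
have [->|an0] := eqVneq a 0.
  by rewrite mulr0; apply: subset_loc => //; apply: subring0.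
case: (loc_valuation hR hPVMD a s tN) => [Vas|[t [Rt nNt] Rtsa]].
  have -> : u * a = u * s * (a / s) by field.
  apply: locM => //; first exact: subring_ideal.
  exact: subset_loc.
case: nNt; apply: colonN => //.
by have -> : t * s = t * (s / a) * a by [field]; apply: IM.
Qed.

(** For [x] in the radical of [I] but not in [I] locally at [M], the elements
    [c] of [(I : x)] have powers in [I] locally at [M]: otherwise the local
    inverse [u] of [c] at [M] would satisfy [u * (c * x) \in I] with [u * c] a
    unit at [M].  Hence [x] too has a local inverse [u] in [inv_ideal R I],
    and [u * x] is a unit at [M] with a power in [I]. *)
Lemma radical_of_inv_colon (hSpec : Spec_t_noetherian R) (I : set K) :
  t_ideal R I -> inv_ideal R I `<=` colon I I -> radical R I `<=` I.
Proof.
move=> tI invI x [Rx [n n_gt0 Ixn]].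
have [[IR I0 ID IM] _ _] := tI.
apply: (t_ideal_local hR tI) => M tM; apply: contrapT => nIx.
have primeM := prime_max tM.
have IsubM : I `<=` M.
  move=> a Ia; apply: contrapT => nMa; apply: nIx.
  by exists a; [split=> //; apply: IR | rewrite mulrC; apply: IM].
have locI0 : loc R M I 0 by apply: subset_loc.
have xn0 : x != 0 by apply: contra_notN nIx => /eqP ->.
have colon_pow c : R c -> I (c * x) -> exists m, loc R M I (c ^+ m.+1).
  move=> Rc Icx; apply: contrapT => noPow.
  have cn0 : c != 0.
    by apply: contra_notN noPow => /eqP ->; exists 0%N; rewrite expr1.
  have [|u [/invI Iu Ruc nMuc]] := inv_ideal_local_inverse hSpec tI tM Rc cn0.
    move=> d Rd Idc; exists 0%N; rewrite expr1.
    have [->|dn0] := eqVneq d 0.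
      by rewrite mul0r; apply: subset_loc => //; apply: subring0.
    case: (loc_valuation hR hPVMD d c tM) => // -[t [Rt nMt] Rtcd].
    case: noPow; exists 1%N; exists t => //.
    by have -> : t * c ^+ 2 = t * (c / d) * (d * c) by [field]; apply: IM.
  by apply: nIx; exists (u * c) => //; rewrite -mulrA; apply: Iu.
have [|u [/invI Iu Rux nMux]] := inv_ideal_local_inverse hSpec tI tM Rx xn0.
  move=> c Rc Icx; have [m [t [Rt nMt] Itc]] := colon_pow c Rc Icx.
  exists m; have [cm0|cmn0] := eqVneq (c ^+ m.+1) 0.
    by rewrite cm0 mul0r; apply: subset_loc => //; apply: subring0.
  case: (loc_valuation hR hPVMD (c ^+ m.+1) x tM) => // -[t' [Rt' nMt'] Rtx].
  case: nIx; exists (t * t').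
    by split; [apply: subringM | apply: (prime_idealNM primeM)].
  have -> : t * t' * x = t' * (x / c ^+ m.+1) * (t * c ^+ m.+1) by field.
  exact: IM.
apply: nMux; apply: (prime_idealX hsR primeM Rux (n := n)); apply: IsubM.
have Iuk k : I (u ^+ k * x ^+ n).
  elim: k => [|k IHk]; first by rewrite mul1r.
  by rewrite exprS -mulrA; apply: Iu.
by rewrite exprMn; apply: Iuk.
Qed.

(** The square of [x * a] is [(x * x * a) * a], and [x * x] is again in
    [inv_ideal R I]. *)
Lemma inv_colon_of_radical (I : set K) :
    t_ideal R I -> is_subring (inv_ideal R I) -> I = radical R I ->
  inv_ideal R I = colon I I.
Proof.
move=> [[IR _ _ IM] _ _] ringI radI; apply/seteqP; split=> x xI a Ia; last first.
  exact/IR/xI.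
rewrite radI; split; [exact: xI | exists 2%N => //].
have -> : (x * a) ^+ 2 = x * x * a * a by ring.
by apply: IM => //; apply: (subringM ringI xI xI).
Qed.

Lemma colon_subring (I : set K) : is_ideal R I -> is_subring (colon I I).
Proof.
case=> _ _ ID IM; split=> [|x y|x y]; rewrite !in_setE;
  [move=> a Ia | move=> xI yI a Ia..].
- by rewrite mul1r.
- rewrite mulrBl; apply: ID; first exact: xI.
  rewrite -mulN1r; apply: IM; last exact: yI.
  by rewrite -sub0r; apply: subringB => //; [apply: subring0 | apply: subring1].
- by rewrite -mulrA; apply/xI/yI.
Qed.

Lemma colon_ideal (I : set K) : is_ideal R I -> is_ideal (colon I I) I.
Proof.
case=> IR I0 ID IM; split=> // [a Ia b Ib|a x]; last exact.
by apply: IM => //; apply: IR.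
Qed.

Lemma subring_sub_colon (I : set K) : is_ideal R I -> R `<=` colon I I.
Proof. by case=> _ _ _ IM r Rr a; apply: IM. Qed.

(** At an [N] containing [I], an element [w] that preserves [I R_N] and has a
    power in it is in [R_N], since otherwise the inverse of [w] would be in
    [R_N] and [1] in [I R_N].  Elsewhere [I R_N] contains all multipliers. *)
Lemma colon_radical (I : set K) w n : t_ideal R I -> I = radical R I ->
  colon I I w -> (0 < n)%N -> I (w ^+ n) -> I w.
Proof.
move=> tI radI wI n_gt0 Iwn; have [[IR I0 ID IM] _ _] := tI.
apply: (t_ideal_local hR tI) => N tN; have primeN := prime_max tN.
have [->|wn0] := eqVneq w 0; first exact: subset_loc.
have [/(loc_full)|nloc1] := pselect (loc R N I 1); first exact.
case: (loc_valuation hR hPVMD w 1 tN) => -[t [Rt nNt]].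
  rewrite divr1 => Rtw; exists t => //; rewrite radI; split=> //; exists n => //.
  by rewrite exprMn; apply: IM => //; apply: subringX.
rewrite div1r => Rtw; case: nloc1; exists (t ^+ n).
  split; first exact: subringX.
  by move=> /(prime_idealX hsR primeN Rt).
have -> : t ^+ n * 1 = (t / w) ^+ n * w ^+ n.
  by rewrite mulr1 expr_div_n divfK // expf_neq0.
by apply: IM => //; apply: subringX.
Qed.

(** Write [T = (I : I)].  The prime [P] is a [t]-ideal because each of its
    elements is multiplied into [I] by an element outside [P], which passes to
    [v]-closures.  It is [t]-maximal because, for [y] outside [P], finitely
    many elements [s0] of [(I : y)], hence of [P], generate with [y] an ideal
    whose inverse is [T].  Indeed, where [y] lies in [I] locally, some element
    of [s0] is a unit, and elsewhere multiplication by [y] maps [I] onto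
    itself, as [I] is locally prime. *)
Lemma t_maximal_of_radical (hSpec : Spec_t_noetherian R) (I P : set K) :
    t_ideal R I -> I = radical R I -> inv_ideal R I = colon I I ->
  minimal_prime_over (colon I I) I P -> t_maximal (colon I I) P.
Proof.
move=> tI radI invI minP; have [idI _ _] := tI; have [IR I0 ID IM] := idI.
have hsT := colon_subring idI; have RT := subring_sub_colon idI.
have idTI := colon_ideal idI; have [primeP IP _] := minP.
have [idP PnT Pprime] := primeP; have [PT P0 PD PM] := idP.
have /(t_idealE hsR)[_ [i Ii in0] _] := tI.
have annihilator f : P f -> exists2 y, colon I I y /\ ~ P y & I (y * f).
  move=> Pf; have [y [n [Ty nPy Iyf]]] := minimal_prime_over_pow hsT idTI minP Pf.
  exists y => //; have [n0|n_gt0] := posnP n.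
    by move: Iyf; rewrite n0 mulr1 => /IP.
  apply: (colon_radical (n := n) tI radI) => //.
    by apply: (subringM hsT) => //; apply: PT.
  rewrite exprMn -{1}(prednK n_gt0) exprSr -mulrA.
  exact: (subringX hsT n.-1 Ty).
have common (s : seq K) : (forall f, f \in s -> P f) ->
    exists2 y, colon I I y /\ ~ P y & forall f, f \in s -> I (y * f).
  elim: s => [|g s IHs] sP.
    exists 1 => //.
    by split; [apply: (subring1 hsT) | apply: prime_idealN1 primeP].
  have [|y [Ty nPy] Iys] := IHs.
    by move=> f sf; apply: sP; rewrite inE sf orbT.
  have [|y' [Ty' nPy'] Iyg] := annihilator g.
    by apply: sP; rewrite inE eqxx.
  exists (y * y').
    by split; [apply: (subringM hsT) | apply: (prime_idealNM primeP)].
  move=> f; rewrite inE => /predU1P [->|/Iys Iyf].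
    by rewrite -mulrA; apply: Ty.
  by rewrite mulrAC mulrC; apply: Ty'.
split=> // [|Q tQ QnT PQ].
  apply/(t_idealE hsT); split=> //; first by exists i => //; apply: IP.
  move=> s z sP sn0 vz; have [y [Ty nPy] Iys] := common s sP.
  have Tz : colon I I z.
    by rewrite -[z]mulr1; apply: vz => f /sP /PT; rewrite mul1r.
  suff /IP /Pprime : I (y * z) by case.
  apply: (t_ideal_local hR tI) => N tN.
  have [f [u [sf Ru nNuf]]] := loc_principal hR hPVMD tN sn0.
  exists (u * f); first by split=> //; apply: Ru.
  have -> : u * f * (y * z) = z * u * (y * f) by ring.
  by apply: vz; [move=> g /Ru /RT | apply: Iys].
apply: contrapT => QneqP.
have [y Qy nPy] : exists2 y, Q y & ~ P y.
  apply: contrapT => noy; apply: QneqP; apply/seteqP; split=> // y Qy.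
  by apply: contrapT => nPy; apply: noy; exists y.
have /(t_idealE hsT)[idQ _ Qcl] := tQ; have [QT Q0 QD QM] := idQ.
have Ty := QT y Qy.
pose X := [set r | R r /\ I (r * y)].
have [||s0 s0X suppX] := @finite_t_maximal_support _ R hsR hSpec X.
- by move=> r [].
- by exists i => //; split; [apply: IR | rewrite mulrC; apply: Ty].
apply: QnT; apply: ideal1_eq => //; apply: (Qcl (y :: s0)).
- move=> f; rewrite inE => /predU1P [-> //|/s0X [Rf Ify]]; apply: PQ.
  by case: (Pprime f y (RT f Rf) Ty (IP _ Ify)).
- exists y; first by rewrite inE eqxx.
  by apply: contra_notN nPy => /eqP ->.
move=> u Tu; rewrite mul1r -invI => a Ia.
apply: (t_ideal_local hR (t_ideal_subring hsR)) => N tN.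
have primeN := prime_max tN.
have [[t [Rt nNt] Ity]|nIy] := pselect (loc R N I y).
  have [k s0k nNk] : exists2 k, k \in s0 & ~ N k.
    apply: contrapT => nok; apply: nNt; apply: (suppX N tN) => // k s0k.
    by apply: contrapT => nNk; apply: nok; exists k.
  exists k; first by case: (s0X k s0k).
  apply: IR; rewrite mulrCA mulrA.
  by apply: Tu => //; rewrite inE s0k orbT.
have IRloc x : loc R N I x -> loc R N R x by case=> t Rt /IR; exists t.
have yn0 : y != 0.
  by apply: contra_notN nIy => /eqP ->; apply: subset_loc.
have [->|an0] := eqVneq a 0.
  by rewrite mulr0; apply: subset_loc => //; apply: subring0.
suff [t [Rt nNt] Itay] : loc R N I (a / y).
  exists t => //; apply: IR.
  have -> : t * (u * a) = u * y * (t * (a / y)) by field.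
  by apply: Tu => //; rewrite inE eqxx.
(* The elements [a / y] and [y] of the valuation ring [R_N] have a product in
   the ideal generated by [I], which is prime. *)
have powI x : loc R N R x -> loc R N I (x ^+ 2) -> loc R N I x.
  move=> [t [Rt nNt] Rtx] [t' [Rt' nNt'] Itx].
  exists (t * t').
    by split; [apply: subringM | apply: (prime_idealNM primeN)].
  rewrite radI; split; first by rewrite mulrAC; apply: subringM.
  exists 2%N => //.
  have -> : (t * t' * x) ^+ 2 = t * t * t' * (t' * x ^+ 2) by ring.
  by apply: IM => //; do 2?apply: subringM => //.
have Iloca : loc R N I a by apply: subset_loc.
have Vay : loc R N R (a / y).
  case: (loc_valuation hR hPVMD a y tN) => // Vya; case: nIy.
  by rewrite -(divfK an0 y); apply: locM.
case: (loc_valuation hR hPVMD (a / y) y tN) => [V1|V2].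
  apply: powI => //.
  have -> : (a / y) ^+ 2 = a / y / y * a by field.
  exact: locM.
case: nIy; apply: powI.
  have -> : y = y / (a / y) * (a / y) by rewrite divfK // mulf_neq0 ?invr_eq0.
  by apply: locM => //; apply: subring_ideal.
have -> : y ^+ 2 = y / (a / y) * a by field; rewrite yn0 an0.
exact: locM.
Qed.

(** It suffices that [x * a] is in [I R_N] for [x] in [inv_ideal R I], [a] in
    [I] and each [t]-maximal [N] containing [I].  In the ring [T = (I : I)], the
    elements with a power in [I R_N] form a prime [P] minimal over [I], and the
    elements that do not map [I R_N] onto itself form a proper [t]-ideal [Q]
    containing [P]; so [P = Q].  If [x] is not in [R_N], then [b = t / x] is in
    [R] for some [t] that is a unit at [N].  If [b] is outside [Q], then
    [x I R_N = t / b I R_N] is [I R_N].  If [b] is in [P], some [b ^+ n] is in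
    [I R_N]; as [x ^+ n.+1] is in the ring [inv_ideal R I], the product
    [x ^+ n.+1 * b ^+ n = t ^+ n * x], and hence [x], is in [R_N] after all. *)
Lemma inv_colon_of_t_maximal (I : set K) :
    t_ideal R I -> is_subring (inv_ideal R I) ->
    (forall P, minimal_prime_over (colon I I) I P -> t_maximal (colon I I) P) ->
  inv_ideal R I = colon I I.
Proof.
move=> tI ringI maxI; have [idI _ _] := tI; have [IR I0 ID IM] := idI.
have hsT := colon_subring idI; have RT := subring_sub_colon idI.
have idTI := colon_ideal idI.
have /(t_idealE hsR)[_ [i Ii in0] _] := tI.
apply/seteqP; split=> x xI a Ia; last exact/IR/xI.
apply: (t_ideal_local hR tI) => N tN; have primeN := prime_max tN.
have [/(loc1 R N I)[b [Rb nNb Ib]]|nloc1] := pselect (loc R N I 1).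
  by exists b => //; rewrite mulrC; apply: IM => //; apply: xI.
have idRR := subring_ideal hsR.
have IlocM c y : loc R N R c -> loc R N I y -> loc R N I (c * y) by apply: locM.
have Vsub r : R r -> loc R N R r by apply: subset_loc.
have VD r r' : loc R N R r -> loc R N R r' -> loc R N R (r + r').
  move=> [t [Rt nNt] Rtr] [t' [Rt' nNt'] Rtr']; exists (t * t').
    by split; [apply: subringM | apply: (prime_idealNM primeN)].
  have -> : t * t' * (r + r') = t' * (t * r) + t * (t' * r') by ring.
  by apply: subringD => //; apply: subringM.
have VX r n : loc R N R r -> loc R N R (r ^+ n).
  move=> Vr; elim: n => [|n IHn]; first by apply: Vsub; apply: subring1.
  by rewrite exprS; apply: locM.
have V1 : loc R N R 1 by apply: Vsub; apply: subring1.
have locI0 : loc R N I 0 by apply: subset_loc.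
have Iloci : loc R N I i by apply: subset_loc.
(* One of two elements divides the other in R_N, hence also their sum. *)
have sumV (w w' : K) : (exists2 v, loc R N R v & w + w' = v * w) \/
                       (exists2 v, loc R N R v & w + w' = v * w').
  have [->|wn0] := eqVneq w 0.
    by right; exists 1; rewrite ?mul1r ?add0r.
  have [->|w'n0] := eqVneq w' 0.
    by left; exists 1; rewrite ?mul1r ?addr0.
  case: (loc_valuation hR hPVMD w w' tN) => Vww; [right|left].
    by exists (w / w' + 1); [apply: VD | field].
  by exists (1 + w' / w); [apply: VD | field].
pose P := [set w | colon I I w /\ exists n, loc R N I (w ^+ n)].
pose Q := [set w | colon I I w /\
  ~ forall y, loc R N I y -> exists2 z, loc R N I z & y = w * z].
have nloct t : R t -> ~ N t -> ~ P t.
  move=> Rt nNt [_ [n Itn]]; apply: nloc1.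
  apply: (loc_cancel hsR primeN (subringX hsR n Rt)); last by rewrite mulr1.
  by move=> /(prime_idealX hsR primeN Rt).
have primeP : prime_ideal (colon I I) P.
  split=> [|PT|w w' Tw Tw' [_ [n Iww]]].
  - split=> [w []//||w w' [Tw [n Iw]] [Tw' [n' Iw']]|b w Tb [Tw [n Iw]]].
    + by split; [apply: (subring0 hsT) | exists 1%N; rewrite expr1].
    + split; first exact: (subringD hsT).
      case: (sumV w w') => -[v Vv ->]; [exists n|exists n'];
        by rewrite exprMn; apply: IlocM => //; apply: VX.
    + split; first exact: (subringM hsT).
      by exists n; rewrite exprMn; apply: loc_act => //; apply: (subringX hsT).
  - apply: (nloct 1 (subring1 hsR)); first exact: prime_idealN1 primeN.
    by rewrite PT; apply: (subring1 hsT).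
  - have [w0|wn0] := eqVneq w 0.
      by left; split=> //; exists 1%N; rewrite expr1 w0.
    have [w'0|w'n0] := eqVneq w' 0.
      by right; split=> //; exists 1%N; rewrite expr1 w'0.
    case: (loc_valuation hR hPVMD w w' tN) => Vww; [left|right];
      split=> //; exists (2 * n)%N; rewrite exprM.
      have -> : w ^+ 2 = w / w' * (w * w') by field.
      by rewrite exprMn; apply: IlocM => //; apply: VX.
    have -> : w' ^+ 2 = w' / w * (w * w') by field.
    by rewrite exprMn; apply: IlocM => //; apply: VX.
have minP : minimal_prime_over (colon I I) I P.
  split=> // [b Ib|P' primeP' IP' P'P].
    by split; [apply/RT/IR | exists 1%N; rewrite expr1; apply: subset_loc].
  apply/seteqP; split=> // w [Tw [n [t [Rt nNt] Itw]]].
  apply: (prime_idealX hsT primeP' Tw (n := n)).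
  have [_ _ /(_ t (w ^+ n))] := primeP'; case=> //; first exact: RT.
  - exact: (subringX hsT).
  - exact: IP'.
  - by move=> /P'P /(nloct t Rt nNt).
have PQ : P `<=` Q.
  move=> w [Tw [n Iwn]]; split=> // surj.
  have wn0 : w != 0.
    apply: contra_neq in0 => w0; have [z _ ->] := surj i Iloci.
    by rewrite w0 mul0r.
  have surjX m : exists2 z, loc R N I z & w ^+ n = w ^+ m * z.
    elim: m => [|m [z Iz ->]]; first by exists (w ^+ n); rewrite ?mul1r.
    have [z' Iz' ->] := surj z Iz; exists z' => //.
    by rewrite exprSr mulrA.
  have [z Iz] := surjX n; rewrite -{1}[w ^+ n]mulr1.
  by move=> /(mulfI (expf_neq0 n wn0)) zE; apply: nloc1; rewrite zE.
have tQ : t_ideal (colon I I) Q.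
  apply/(t_idealE hsT); split.
  - split=> [w []//||w w' [Tw nw] [Tw' nw']|b w Tb [Tw nw]].
    + by apply: PQ; case: primeP => -[].
    + split; first exact: (subringD hsT).
      case: (sumV w w') => -[v Vv ->] surj; [apply: nw|apply: nw'] => y Iy;
        have [z Iz ->] := surj y Iy; exists (v * z); by [apply: IlocM | ring].
    + split; first exact: (subringM hsT).
      move=> surj; apply: nw => y Iy; have [z Iz ->] := surj y Iy.
      by exists (b * z); [apply: loc_act | rewrite mulrCA mulrA].
  - by exists i => //; apply: PQ; case: minP => _ + _; apply.
  - move=> s z sQ sn0 vz; split.
      by rewrite -[z]mulr1; apply: vz => f /sQ []; rewrite mul1r.
    move=> surj; have [f [u [sf Ru nNuf]]] := loc_principal hR hPVMD tN sn0.
    (* At N the fractional ideal generated by s is that of f, so f divides z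
       there, with a quotient that preserves I R_N. *)
    have [_ []] := sQ f sf => y Iy; have [b Ib ->] := surj y Iy.
    have uf0 : u * f != 0.
      by apply: contra_notN nNuf => /eqP ->; case: primeN => -[].
    have [u0 f0] : u != 0 /\ f != 0 by apply/andP; rewrite -negb_or -mulf_eq0.
    exists (z * u * b / (u * f)); last by field; rewrite u0 f0.
    apply: (loc_cancel hsR primeN (Ru f sf) nNuf).
    rewrite mulrC divfK //; apply: loc_act => //.
    by apply: vz => g /Ru /RT.
have QP : Q = P.
  have [_ _ maxP] := maxI P minP; apply: maxP => // QT.
  have : Q 1 by rewrite QT; apply: (subring1 hsT).
  by case=> _; apply=> y Iy; exists y; rewrite ?mul1r.
have [x0|xn0] := eqVneq x 0; first by rewrite x0 mul0r.
have Iloca : loc R N I a by apply: subset_loc.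
case: (loc_valuation hR hPVMD x 1 tN) => [|[t [Rt nNt] Rb]].
  by rewrite divr1 => Vx; apply: IlocM.
rewrite div1r in Rb.
have [Pb|] := pselect (P (t / x)); last first.
  rewrite -QP => nQb; have [y Iy ->] : exists2 y, loc R N I y & a = t / x * y.
    by apply: contrapT => noy; apply: nQb; split; [apply: RT | move/(_ a Iloca)].
  have -> : x * (t / x * y) = t * y by field.
  by apply: IlocM => //; apply: Vsub.
have [_ [n [t' [Rt' nNt'] Itb]]] := Pb.
apply: IlocM => //; apply: (loc_cancel hsR primeN Rt' nNt').
apply: (loc_cancel hsR primeN (subringX hsR n Rt)).
  by move=> /(prime_idealX hsR primeN Rt).
apply: Vsub.
have -> : t ^+ n * (t' * x) = x ^+ n.+1 * (t' * (t / x) ^+ n).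
  by rewrite exprS expr_div_n; field; rewrite expf_neq0.
exact: (subringX ringI n.+1 xI).
Qed.

End MainImplications.

Theorem theorem2p5 (K : fieldType) (R : set K)
    (hR : domain_with_quotient_field R)
    (hPVMD : PVMD R)
    (hSpec : Spec_t_noetherian R)
    (I : set K) (hI : t_ideal R I)
    (hring : is_subring (inv_ideal R I)) :
  [<-> inv_ideal R I = colon I I;
       I = radical R I;
       forall P : set K, minimal_prime_over (colon I I) I P ->
         t_maximal (colon I I) P].
Proof.
have invE := inv_colon_of_radical hI hring.
tfae=> [invI|radI P|maxI].
- apply/seteqP; split=> [x Ix|].
    by split; [case: hI => -[+ _ _ _] _ _; apply | exists 1%N].
  by apply: radical_of_inv_colon => //; rewrite invI.
- exact: t_maximal_of_radical (invE radI).
- exact: inv_colon_of_t_maximal.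
Qed.
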